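(* Let $\lambda\in\mathbb{R}$. For all integers $m,n\ge 0$, \[ \mathrm{Bel}_{n+m,\lambda}(x)= \sum_{k=0}^{n}\sum_{j=0}^{m}\binom{n}{k}S_{2,\lambda}(m,j)\,\mathrm{Bel}_{k,\lambda}(x)\,(j-m\lambda)_{n-k,\lambda}\,x^{j}. \]
   Context: For $\lambda\in\mathbb{R}$, $(x)_{0,\lambda}=1$ and $(x)_{n,\lambda}=x(x-\lambda)\cdots(x-(n-1)\lambda)$ for $n\ge1$; $(x)_0=1$ and $(x)_n=x(x-1)\cdots(x-n+1)$. The degenerate Stirling numbers of the second kind $S_{2,\lambda}(n,k)$ are defined by $(x)_{n,\lambda}=\sum_{k=0}^{n}S_{2,\lambda}(n,k)(x)_{k}$. The degenerate exponential is $e_\lambda(t)=\sum_{k\ge0}(1)_{k,\lambda}t^k/k!$, and the degenerate Bell polynomials are defined by $e^{x(e_{\lambda}(t)-1)}=\sum_{n=0}^{\infty}\mathrm{Bel}_{n,\lambda}(x)\frac{t^{n}}{n!}$ (equivalently $\mathrm{Bel}_{n,\lambda}(x)=\sum_{k=0}^nS_{2,\lambda}(n,k)x^k$). *)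

(* Defs.v *)
From mathcomp Require Import all_boot all_order all_algebra.
From mathcomp Require Import reals.

Set Implicit Arguments.
Unset Strict Implicit.
Unset Printing Implicit Defensive.

Import Order.TTheory GRing.Theory Num.Theory.
Local Open Scope ring_scope.

(* (x)_{n,l} and (x)_n, in any commutative ring: they are used both on
   scalars and on the indeterminate 'X of {poly R}. *)
Definition degfall (A : comNzRingType) (l x : A) (n : nat) : A :=
  \prod_(i < n) (x - i%:R * l).

Definition fall (A : comNzRingType) (x : A) (n : nat) : A :=
  \prod_(i < n) (x - i%:R).

(* The identity (x)_{n,l} = sum_(k <= n) S n k (x)_k is between polynomials in
   x.  It determines S n k exactly for k <= n, and leaves the values at k > n
   unspecified: see is_degstirling2_exists and is_degstirling2_uniq. *)
Definition is_degstirling2 (R : realType) (l : R) (S : nat -> nat -> R) :=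
  forall n : nat,
    degfall l%:P 'X n = \sum_(k < n.+1) S n k *: fall ('X : {poly R}) k.

(* A formal power series in t is the sequence of its coefficients. *)
Definition fps_mul (A : comNzRingType) (f g : nat -> A) : nat -> A :=
  fun n => \sum_(i < n.+1) f i * g (n - i)%N.

Definition fps_one (A : comNzRingType) : nat -> A := fun n => (n == 0%N)%:R.

Definition fps_pow (A : comNzRingType) (f : nat -> A) (k : nat) : nat -> A :=
  iter k (fps_mul f) (fps_one A).

(* sum_k f^k / k!, meaningful only when f 0 = 0: then f^k has no term of degree
   < k, so that the sum over k giving the coefficient of t^n stops at n. *)
Definition fps_exp (R : realType) (f : nat -> {poly R}) : nat -> {poly R} :=
  fun n => \sum_(k < n.+1) (k`!%:R : R)^-1 *: fps_pow f k n.

Definition degexp (R : realType) (l : R) : nat -> R :=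
  fun n => degfall l 1 n / n`!%:R.

(* The series x (e_l(t) - 1) in t, with coefficients in R[x]; its constant term
   vanishes since e_l(0) = 1. *)
Definition degbell_exponent (R : realType) (l : R) : nat -> {poly R} :=
  fun n => (degexp l n - fps_one R n) *: 'X.

(* n! times the coefficient of t^n in e^{x (e_l(t) - 1)}. *)
Definition degbell (R : realType) (l : R) (n : nat) : {poly R} :=
  (n`!%:R : R) *: fps_exp (degbell_exponent l) n.

Lemma degbell_exponent0 (R : realType) (l : R) : degbell_exponent l 0 = 0.
Proof.
by rewrite /degbell_exponent /degexp /degfall /fps_one big_ord0 fact0 divr1
  subrr scale0r.
Qed.

Lemma is_degstirling2_exists (R : realType) (l : R) :
  exists S, is_degstirling2 l S.
Proof.
suff H n : exists s : nat -> R,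
    degfall l%:P 'X n = \sum_(k < n.+1) s k *: fall ('X : {poly R}) k.
  have H' n : exists s : seq R,
      degfall l%:P 'X n = \sum_(k < n.+1) s`_k *: fall ('X : {poly R}) k.
    have [s ->] := H n; exists (mkseq s n.+1).
    by apply: eq_bigr => k _; rewrite nth_mkseq.
  have H'' n : exists s : seq R,
      degfall l%:P 'X n == \sum_(k < n.+1) s`_k *: fall ('X : {poly R}) k.
    by have [s ->] := H' n; exists s.
  by exists (fun n k => (xchoose (H'' n))`_k) => n; apply/eqP/(xchooseP (H'' n)).
elim: n => [|n [s Hs]].
  by exists (fun=> 1); rewrite big_ord1 scale1r /degfall /fall !big_ord0.
exists (fun k => (if k is k'.+1 then s k' else 0) +
                 (if (k <= n)%N then (k%:R - n%:R * l) * s k else 0)).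
rewrite /degfall big_ord_recr /= -/(degfall _ _ _) Hs mulr_suml.
under [RHS]eq_bigr do rewrite scalerDl.
rewrite [RHS]big_split /= [X in _ = X + _]big_ord_recl /= scale0r add0r.
rewrite [X in _ = _ + X]big_ord_recr /= ltnn scale0r addr0 -big_split /=.
apply: eq_bigr => k _.
rewrite -ltnS ltn_ord /bump add1n {2}/fall big_ord_recr /= -/(fall _ _).
rewrite [_ * s k]mulrC -scalerA -scalerDr -scalerAl.
congr (_ *: _); rewrite scalerBl !mulrBr -!mul_polyC.
by rewrite polyCM !polyC_natr ![_ * fall _ _]mulrC addrA subrK.
Qed.

Lemma is_degstirling2_uniq (R : realType) (l : R) (S T : nat -> nat -> R) :
  is_degstirling2 l S -> is_degstirling2 l T ->
  forall n k, (k <= n)%N -> S n k = T n k.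
Proof.
move=> HS HT n k le_kn.
have fallS j : size (fall ('X : {poly R}) j) = j.+1.
  rewrite /fall; under eq_bigr do rewrite -polyC_natr.
  by rewrite -(big_enum _ _ predT) size_prod_XsubC size_enum_ord.
suff H N (c : nat -> R) : \sum_(i < N) c i *: fall ('X : {poly R}) i = 0 ->
    forall i, (i < N)%N -> c i = 0.
  apply/eqP; rewrite -subr_eq0; apply/eqP.
  apply: (H n.+1 (fun i => S n i - T n i)) => //.
  under eq_bigr do rewrite scalerBl.
  by rewrite sumrB -HS -HT subrr.
elim: N => [|N IH] //; rewrite big_ord_recr /= => H.
have cN : c N = 0.
  have /(congr1 (fun p : {poly R} => p`_N)) := H.
  rewrite coefD coefZ coef0 coef_sum big1 ?add0r => [/eqP|i _].
    rewrite mulf_eq0 => /orP[/eqP //|].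
    have -> : (fall ('X : {poly R}) N)`_N = lead_coef (fall 'X N).
      by rewrite /lead_coef fallS.
    by rewrite lead_coef_eq0 -size_poly_eq0 fallS.
  by rewrite coefZ nth_default ?mulr0 // fallS.
move: H; rewrite cN scale0r addr0 => /IH H i.
by rewrite ltnS leq_eqVlt => /orP[/eqP ->|/H].
Qed.

(* Main.v *)
(** Let [umbral] be the linear map of R[x] sending x^k to the falling factorial
    (x)_k.  It is injective, it turns multiplication by x^j into
    p(x) |-> (x)_j p(x - j), and it sends Bel_{n,l}(x) to (x)_{n,l}: at a natural
    number N the last fact reads n! [t^n] (1 + (e_l(t) - 1))^N = (N)_{n,l}, which
    holds since e_l(t)^N has coefficients (N)_{n,l} / n!.  Applying [umbral] to both sides,
    the theorem becomes (x)_{n+m,l} = (x)_{m,l} (x - m l)_{n,l}, with (x)_{m,l}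
    expanded in the (x)_j and (x - m l)_{n,l} = ((x - j) + (j - m l))_{n,l}
    expanded by the Vandermonde convolution. *)
Require Import Defs.
From HB Require Import structures.
From mathcomp Require Import all_boot all_order all_algebra.
From mathcomp Require Import reals.
From mathcomp Require Import ring.

Set Implicit Arguments.
Unset Strict Implicit.
Unset Printing Implicit Defensive.

Import Order.TTheory GRing.Theory Num.Theory.
Local Open Scope ring_scope.

(** * Falling factorials *)

Lemma degfallS (A : comNzRingType) (l x : A) n :
  degfall l x n.+1 = degfall l x n * (x - n%:R * l).
Proof. by rewrite /degfall big_ord_recr. Qed.

Lemma degfallD (A : comNzRingType) (l x : A) m n :
  degfall l x (m + n) = degfall l x m * degfall l (x - m%:R * l) n.
Proof.
rewrite /degfall big_split_ord /=; congr (_ * _).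
by apply: eq_bigr => i _; rewrite natrD mulrDl opprD addrA.
Qed.

Lemma rmorph_degfall (A B : comNzRingType) (f : {rmorphism A -> B}) (l x : A) n :
  f (degfall l x n) = degfall (f l) (f x) n.
Proof.
rewrite rmorph_prod; apply: eq_bigr => i _.
by rewrite rmorphB rmorphM rmorph_nat.
Qed.

Lemma degfall_vandermonde (A : comNzRingType) (l x y : A) n :
  degfall l (x + y) n =
    \sum_(k < n.+1) 'C(n, k)%:R * (degfall l x k * degfall l y (n - k)).
Proof.
elim: n => [|n IH].
  by rewrite big_ord1 /degfall !big_ord0 bin0 !mul1r.
rewrite degfallS IH mulr_suml [RHS]big_ord_recl bin0 mul1r subn0.
under [in RHS]eq_bigr => k _ do
  rewrite lift0 binS natrD mulrDl subSS.
rewrite big_split /= addrA.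
rewrite [X in _ = _ + X + _]big_ord_recr /= bin_small // mul0r addr0.
have -> : degfall l x 0 * degfall l y n.+1 +
    \sum_(k < n) 'C(n, k.+1)%:R * (degfall l x k.+1 * degfall l y (n - k)) =
    \sum_(k < n.+1) 'C(n, k)%:R * (degfall l x k * degfall l y (n.+1 - k)).
  by rewrite [RHS]big_ord_recl /= bin0 mul1r subn0.
(* After Pascal's rule, the terms match because x + y - n l is (x - k l) + (y - (n - k) l), each
   summand extending one of the two products. *)
rewrite -big_split; apply: eq_bigr => k _ /=.
have le_kn : (k <= n)%N by rewrite -ltnS.
rewrite subSn // !degfallS natrB //; ring.
Qed.

Lemma fallE (A : comNzRingType) (x : A) n : fall x n = degfall 1 x n.
Proof. by apply: eq_bigr => i _; rewrite mulr1. Qed.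

Lemma fallD (A : comNzRingType) (x : A) m n :
  fall x (m + n) = fall x m * fall (x - m%:R) n.
Proof. by rewrite !fallE degfallD mulr1. Qed.

Lemma rmorph_fall (A B : comNzRingType) (f : {rmorphism A -> B}) (x : A) n :
  f (fall x n) = fall (f x) n.
Proof. by rewrite !fallE rmorph_degfall rmorph1. Qed.

Lemma fall_nat (A : comNzRingType) N k :
  fall (N%:R : A) k = ('C(N, k) * k`!)%:R.
Proof.
rewrite bin_ffact; elim: k => [|k IH]; first by rewrite /fall big_ord0.
rewrite /fall big_ord_recr /= -/(fall _ _) IH ffactnSr natrM.
(* The truncated N - k differs from the ring subtraction only for k > N, where [N ^_ k] is already
   0. *)
have [le_kN|lt_Nk] := leqP k N; first by rewrite natrB.
by rewrite ffact_small // !mul0r.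
Qed.

(** The naturals are distinct in [A], so p - q has at least as many roots as its size. *)
Lemma poly_eq_nat (A : numDomainType) (p q : {poly A}) :
  (forall N : nat, p.[N%:R] = q.[N%:R]) -> p = q.
Proof.
move=> eq_pq; apply/eqP; rewrite -subr_eq0; apply/eqP.
apply: (@roots_geq_poly_eq0 _ _ [seq i%:R | i <- iota 0 (size (p - q))]).
- by apply/allP => _ /mapP[i _ ->]; rewrite /root !hornerE eq_pq subrr.
- by rewrite map_inj_uniq ?iota_uniq //; apply: mulrIn; rewrite oner_eq0.
- by rewrite size_map size_iota.
Qed.

(** * Powers of formal power series *)

Lemma fps_powS (A : comNzRingType) (f : nat -> A) k i :
  fps_pow f k.+1 i = \sum_(j < i.+1) f j * fps_pow f k (i - j).
Proof. by []. Qed.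

Section Series.
Variable A : comNzRingType.
Implicit Types (f : nat -> A) (N i k : nat).

(** Truncation at order N does not affect lower coefficients of powers; the binomial theorem for
    polynomials thus becomes available for series. *)
Lemma coef_poly_exp f N i k : (i < N)%N ->
  ((\poly_(j < N) f j) ^+ k)`_i = fps_pow f k i.
Proof.
elim: k i => [|k IH] i lt_iN; first by rewrite expr0 coef1.
rewrite exprS coefM fps_powS.
apply: eq_bigr => j _.
rewrite coef_poly (leq_ltn_trans _ lt_iN) -1?ltnS // IH //.
exact: leq_ltn_trans (leq_subr _ _) lt_iN.
Qed.

Lemma fps_pow_small f i k : f 0 = 0 -> (i < k)%N -> fps_pow f k i = 0.
Proof.
move=> f0; elim: k i => // k IH i lt_ik.
rewrite fps_powS big_ord_recl f0 mul0r add0r big1 // => j _.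
rewrite IH ?mulr0 // lift0; case: i lt_ik j => [|i] lt_ik j; first by case: j.
by rewrite subSS (leq_ltn_trans (leq_subr _ _)).
Qed.

Lemma fps_pow_scaleX f k i :
  fps_pow (fun n => f n *: 'X) k i = fps_pow f k i *: 'X^k.
Proof.
elim: k i => [|k IH] i.
  by rewrite /= /fps_one expr0 -mul_polyC mulr1 polyC_natr.
rewrite !fps_powS scaler_suml; apply: eq_bigr => j _.
by rewrite IH -scalerAl -scalerAr scalerA exprS.
Qed.

End Series.

(** * Coefficients of the degenerate Bell polynomials *)

Section Bell.
Variables (R : realType) (l : R).

(** Multiplying by one more e_l(t) is the Vandermonde convolution for 1 + N, divided by n!. *)
Lemma fps_pow_degexp N n : fps_pow (degexp l) N n = degfall l N%:R n / n`!%:R.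
Proof.
elim: N n => [|N IH] n.
  case: n => [|n]; first by rewrite /degfall big_ord0 fact0 divr1.
  by rewrite /degfall big_ord_recl mul0r subr0 !mul0r.
rewrite fps_powS.
under eq_bigr do rewrite IH /degexp.
rewrite -natr1 addrC degfall_vandermonde mulr_suml.
apply: eq_bigr => k _; have le_kn : (k <= n)%N by rewrite -ltnS.
have nzf i : (i`!%:R : R) != 0 by rewrite pnatr_eq0 -lt0n fact_gt0.
by rewrite -(bin_fact le_kn) !natrM; field; rewrite !nzf pnatr_eq0 -lt0n bin_gt0.
Qed.

Definition expm1_coef (n : nat) : R := degexp l n - fps_one R n.

Lemma expm1_coef0 : expm1_coef 0 = 0.
Proof.
by rewrite /expm1_coef /degexp /degfall /fps_one big_ord0 fact0 divr1 subrr.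
Qed.

(** Binomial expansion of e_l(t)^N with e_l(t) = 1 + (e_l(t) - 1), carried out on truncations. *)
Lemma sum_bin_expm1 N n :
  \sum_(k < n.+1) 'C(N, k)%:R * fps_pow expm1_coef k n =
    degfall l N%:R n / n`!%:R.
Proof.
pose F := \poly_(j < n.+1) expm1_coef j.
rewrite -fps_pow_degexp -(@coef_poly_exp _ _ n.+1) //.
have -> : \poly_(j < n.+1) degexp l j = 1 + F.
  apply/polyP => i; rewrite coefD coef1 !coef_poly.
  case: ifP => [_|]; first by rewrite /expm1_coef addrC subrK.
  by case: i => [|i]; rewrite ?addr0.
rewrite exprDn coef_sum.
have binF k : (1 ^+ (N - k) * F ^+ k *+ 'C(N, k))`_n =
    'C(N, k)%:R * fps_pow expm1_coef k n.
  by rewrite expr1n mul1r coefMn coef_poly_exp // mulr_natl.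
under [RHS]eq_bigr do rewrite binF.
(* One sum stops at n, the other at N. In a common range the extra terms vanish: the binomial for k
   > N, the coefficient of t^n for k > n. *)
pose G k := 'C(N, k)%:R * fps_pow expm1_coef k n.
rewrite (big_ord_widen (n + N).+1 G) ?ltnS ?leq_addr //.
rewrite (big_ord_widen (n + N).+1 G) ?ltnS ?leq_addl //.
rewrite [LHS]big_mkcond [RHS]big_mkcond; apply: eq_bigr => k _ /=.
rewrite /G; case: ltnP => [_|lt_nk]; case: ltnP => // lt_Nk.
- by rewrite bin_small // mul0r.
- by rewrite fps_pow_small ?mulr0 // expm1_coef0.
Qed.

Lemma degbellE n :
  degbell l n =
    \poly_(k < n.+1) (n`!%:R / k`!%:R * fps_pow expm1_coef k n).
Proof.
rewrite /degbell /fps_exp poly_def scaler_sumr; apply: eq_bigr => k _.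
by rewrite (fps_pow_scaleX expm1_coef) !scalerA.
Qed.

End Bell.

(** * The umbral map *)

Section Umbral.
Variable R : realType.

Definition umbral (p : {poly R}) : {poly R} :=
  \sum_(i < size p) p`_i *: fall 'X i.

Lemma umbral_widen (p : {poly R}) N : (size p <= N)%N ->
  umbral p = \sum_(i < N) p`_i *: fall 'X i.
Proof.
move=> le_pN; rewrite /umbral (big_ord_widen N (fun i => p`_i *: fall 'X i)) //.
rewrite big_mkcond; apply: eq_bigr => i _ /=.
by case: ltnP => // le_pi; rewrite nth_default // scale0r.
Qed.

Lemma umbral_is_linear : linear umbral.
Proof.
move=> a p q; pose N := maxn (size (a *: p + q)) (maxn (size p) (size q)).
rewrite !(@umbral_widen _ N) ?leq_max ?leqnn ?orbT // scaler_sumr -big_split.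
by apply: eq_bigr => i _; rewrite coefD coefZ scalerDl scalerA.
Qed.

HB.instance Definition _ :=
  GRing.isLinear.Build R {poly R} {poly R} _ umbral umbral_is_linear.

Lemma umbralXn n : umbral 'X^n = fall 'X n.
Proof.
rewrite /umbral size_polyXn big_ord_recr /= coefXn eqxx scale1r big1 ?add0r //.
by move=> i _; rewrite coefXn (ltn_eqF (ltn_ord i)) scale0r.
Qed.

(* A kernel element could be added to one row of the Stirling numbers, against
   their uniqueness. *)
Lemma umbral_inj : injective umbral.
Proof.
suff ker0 q : umbral q = 0 -> q = 0.
  move=> p q eq_pq; apply/eqP; rewrite -subr_eq0; apply/eqP/ker0.
  by rewrite raddfB /= eq_pq subrr.
move=> q0; have [S HS] := is_degstirling2_exists (0 : R).
(* Row [size q] is long enough for uniqueness, which only covers k <= n, to reach every coefficient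
   of q. *)
pose T n k := S n k + (if n == size q then q`_k else 0).
have HT : is_degstirling2 0 T.
  move=> n; under eq_bigr do rewrite scalerDl.
  rewrite big_split /= -HS; case: eqP => [->|_].
    by rewrite -umbral_widen // q0 addr0.
  by rewrite big1 ?addr0 // => i _; rewrite scale0r.
apply/polyP => k; rewrite coef0.
have [le_qk|lt_kq] := leqP (size q) k; first by rewrite nth_default.
have := is_degstirling2_uniq HS HT (ltnW lt_kq).
by rewrite /T eqxx -[LHS]addr0 => /addrI.
Qed.

(** By linearity this reduces to monomials, where it is (x)_{j+i} = (x)_j (x - j)_i. *)
Lemma umbral_mulXn (p : {poly R}) j :
  umbral (p * 'X^j) = fall 'X j * (umbral p \Po ('X - j%:R)).
Proof.
rewrite -[in LHS](coefK p) poly_def mulr_suml raddf_sum /=.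
rewrite [in RHS]/umbral linear_sum mulr_sumr; apply: eq_bigr => i _.
rewrite -scalerAl -exprD addnC linearZ /= umbralXn fallD.
by rewrite linearZ /= -scalerAr rmorph_fall /= comp_polyX.
Qed.

Lemma umbral_degbell (l : R) n : umbral (degbell l n) = degfall l%:P 'X n.
Proof.
apply: poly_eq_nat => N.
rewrite -!horner_evalE rmorph_degfall /= !horner_evalE hornerC hornerX.
have nzf i : (i`!%:R : R) != 0 by rewrite pnatr_eq0 -lt0n fact_gt0.
rewrite degbellE (@umbral_widen _ n.+1) ?size_poly // horner_sum.
(* Since (N)_k = C(N, k) k!, the k! in the denominator from [degbellE] cancels, leaving n! times the
   sum of [sum_bin_expm1]. *)
rewrite -[RHS](mulfVK (nzf n)) -sum_bin_expm1 mulr_suml.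
apply: eq_bigr => k _; rewrite hornerZ coef_poly ltn_ord.
rewrite -horner_evalE rmorph_fall /= horner_evalE hornerX fall_nat natrM.
by field; rewrite nzf.
Qed.

End Umbral.

Theorem theorem12 (R : realType) (l : R) (S2 : nat -> nat -> R)
    (hS2 : is_degstirling2 l S2) (m n : nat) :
  degbell l (n + m) =
    \sum_(k < n.+1) \sum_(j < m.+1)
      ('C(n, k)%:R * S2 m j * degfall l (j%:R - m%:R * l) (n - k))
        *: (degbell l k * 'X^j).
Proof.
apply: umbral_inj.
rewrite umbral_degbell addnC degfallD hS2 mulr_suml.
rewrite exchange_big linear_sum; apply: eq_bigr => j _.
have -> : 'X - m%:R * l%:P = ('X - j%:R) + (j%:R - m%:R * l)%:P :> {poly R}.
  by rewrite polyCB polyCM !polyC_natr addrA subrK.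
rewrite degfall_vandermonde mulr_sumr linear_sum; apply: eq_bigr => k _ /=.
rewrite linearZ /= umbral_mulXn umbral_degbell rmorph_degfall /=.
(* The shift by j turns (x)_{k,l} into (x - j)_{k,l}, the first Vandermonde factor; the second is
   the constant (j - m l)_{n-k,l}. *)
rewrite comp_polyC comp_polyX -rmorph_degfall /= -!mul_polyC !polyCM polyC_natr.
ring.
Qed.
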